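(* Let $k$ be an algebraically closed field of characteristic $2$, let $\bar a,\bar b,\bar c,\bar e\in k$ with $\bar c\bar e\ne0$, and let $Q\subset\mathbb P^2(k)$ be the integral plane projective quartic curve \[ \bar c x^4+(z^2+\bar b y^2+\bar a\bar b x^2)\bigl(\bar e(z^2+\bar b y^2+\bar a\bar b x^2)+(y^2+xy+\bar a x^2)\bigr)=0, \] whose unique singular point is $(0:1:\bar b^{1/2})$. Then the tangents of $Q$ at its smooth points have a common intersection point, namely $(0:0:1)$, and each of them is a bitangent or passes through the singular point $(0:1:\bar b^{1/2})$. In particular $Q$ does not admit ordinary inflection points. However, $Q$ has exactly two non-ordinary inflection points, which are the points where the two tangency points of a bitangent coincide; they are the points $(\bar x:\bar y:\bar z)$ of $Q$ with $\bar y^2+\bar x\bar y+\bar a\bar x^2=0$.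
   Context: An inflection point of the plane quartic is a smooth point whose tangent line meets the curve there with intersection multiplicity at least $3$; it is ordinary if the multiplicity is exactly $3$ and non-ordinary if it is $4$. A bitangent is a line tangent to the curve at two smooth points; the degenerate case in which the two tangency points coincide (the tangent at a non-ordinary inflection point) is included. *)

(* Defs.v *)
(* Mathematical Components, with multinomials for multivariate polynomials. *)
From mathcomp Require Export all_boot all_order all_algebra.
From mathcomp.multinomials Require Export mpoly.

Set Implicit Arguments.
Unset Strict Implicit.
Unset Printing Implicit Defensive.

Import GRing.Theory.
Local Open Scope ring_scope.

(* Points of P^2(k) and lines of P^2(k) are both given by nonzero row vectors
   in k^3: a point by homogeneous coordinates, a line by the coefficients of
   its equation.  Two nonzero vectors u, v give the same point (or line) iff
   (u == v)%MS, i.e. iff they span the same one-dimensional subspace. *)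

Section PlaneCurves.
Variable k : fieldType.
Implicit Types (F : {mpoly k[3]}) (P R l : 'rV[k]_3).

Definition pt (x y z : k) : 'rV[k]_3 := \row_i [:: x; y; z]`_i.

Definition on_line l P : bool := P *m l^T == 0.

(* In the definitions below F is meant to be homogeneous: F = 0 is a plane
   projective curve. *)
Definition on_curve F P : bool := (P != 0) && (F.@[P 0] == 0).

Definition gradient F P : 'rV[k]_3 := \row_i (F^`M(i)).@[P 0].

Definition smooth_point F P : bool := on_curve F P && (gradient F P != 0).

Definition singular_point F P : bool := on_curve F P && (gradient F P == 0).

Definition irreducible_form F : Prop :=
  [/\ F != 0, F \isn't a GRing.unit &
      forall G H, F = G * H -> G \is a GRing.unit \/ H \is a GRing.unit].

(* Meaningful at a smooth point P: the line F_x(P) X + F_y(P) Y + F_z(P) Z = 0. *)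
Definition tangent_line F P : 'rV[k]_3 := gradient F P.

Definition tangent_at F l P : bool :=
  smooth_point F P && (l == tangent_line F P)%MS.

(* The univariate polynomial F(P + t R). *)
Definition restrict_to_line F P R : {poly k} :=
  mmap (@polyC k) (fun i => (P 0 i)%:P + R 0 i *: 'X) F.

(* For P on l: the intersection multiplicity of l and F = 0 at P is at least m,
   i.e. F vanishes at P to order at least m along l.  For R on l different
   from P, the points of l near P are the P + t R, and t is a uniformizer of
   l at P.  The polynomial F(P + t R) is 0 exactly when l lies in the curve;
   the multiplicity is then infinite. *)
Definition mult_ge F l P (m : nat) : Prop :=
  forall R, on_line l R -> row_free (col_mx P R) ->
    'X^m %| restrict_to_line F P R.

Definition mult_eq F l P (m : nat) : Prop :=
  mult_ge F l P m /\ ~ mult_ge F l P m.+1.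

Definition inflection_point F P : Prop :=
  smooth_point F P /\ mult_ge F (tangent_line F P) P 3.

Definition ordinary_inflection_point F P : Prop :=
  inflection_point F P /\ mult_eq F (tangent_line F P) P 3.

Definition nonordinary_inflection_point F P : Prop :=
  inflection_point F P /\ mult_eq F (tangent_line F P) P 4.

(* The two tangency points P and P' may coincide only at a non-ordinary
   inflection point. *)
Definition bitangent F l : Prop :=
  exists P P', [/\ tangent_at F l P, tangent_at F l P' &
                   (P == P')%MS -> nonordinary_inflection_point F P].

Definition quartic (a b c e : k) : {mpoly k[3]} :=
  let x := 'X_(@Ordinal 3 0 isT) in
  let y := 'X_(@Ordinal 3 1 isT) in
  let z := 'X_(@Ordinal 3 2 isT) in
  let q := z ^+ 2 + b *: y ^+ 2 + (a * b) *: x ^+ 2 in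
  c *: x ^+ 4 + q * (e *: q + (y ^+ 2 + x * y + a *: x ^+ 2)).

End PlaneCurves.

(* Main.v *)
Require Import Defs.
From mathcomp Require Import ring.

Set Implicit Arguments.
Unset Strict Implicit.
Unset Printing Implicit Defensive.

Import GRing.Theory.
Local Open Scope ring_scope.

(** Since [a], [b] are squares in [k], so are the coefficients of
    z^2 + b y^2 + a b x^2, which in characteristic 2 is therefore the square of
    the linear form u = z + s y + r s x with r^2 = a, s^2 = b.  The quartic is
    c x^4 + u^2 (e u^2 + N) where N = y^2 + x y + a x^2.

    Differentiation kills every square, and the only term of the quartic
    that is not a combination of squares is u^2 x y.  Hence the gradient at
    (x : y : z) is u^2 (y, x, 0) ([gradient_quartic]).  Every tangent at a
    smooth point P is therefore the line that joins P to (0 : 0 : 1), and the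
    singular points are those with u = 0, so x = 0 (the case x = y = 0 forces
    z = 0).  Along the tangent at P the quartic has no terms of degree 0, 1, 3
    in the parameter ([restrict_tangent]), and in the direction of (0 : 0 : 1)
    it is N(P) t^2 + e t^4 ([restrict_tangent_vertical]).  The intersection
    multiplicity at P is thus 2 when N(P) is nonzero and 4 otherwise, which
    excludes ordinary inflection points and identifies the non-ordinary ones
    ([nonordinaryP]).  If x is nonzero, the line through P and (0 : 0 : 1) meets
    the quartic again at the point obtained by adding to z a square root of
    N(P)/e, with the same tangent ([tangent_bitangent]); the two points coincide
    exactly when N(P) = 0.  If x = 0 at P, the tangent is the line x = 0, which
    contains (0 : 1 : s).  On N = 0 the ratio y/x is one of the two roots of the
    separable polynomial t^2 + t + a, and then e u^4 = c x^4 has a single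
    solution u because fourth roots are unique ([two_nonordinary]).

    For irreducibility, u replaces z as a coordinate and the quartic is seen as
    a polynomial of degree 2 in y over k[x, u].  A factor without y divides the
    coefficient u^2 and the constant term, which contains c x^4, so it is
    constant.  Two factors linear in y would, on x = 1, solve
    Y^2 + Y = c/u^2 + e u^2 + a over k(u), an Artin-Schreier equation whose
    pole at u = 0 reduces to a simple one and thus cannot be removed
    ([no_linear_splitting]). *)

(** * Characteristic 2 and algebraically closed fields *)

(** Lets [ring] prove identities that hold only modulo 2: [t] is half the
    difference of the two sides, computed in characteristic 0. *)
Lemma eq_pchar2 (R : nzRingType) (hR : 2%N \in [pchar R]) (t v w : R) :
  v = w + 2%:R * t -> v = w.
Proof. by move=> ->; rewrite (pcharf0 hR) mul0r addr0. Qed.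

Lemma closed_sqrt (k : closedFieldType) (v : k) : exists w, w ^+ 2 = v.
Proof.
have [w] := solve_monicpoly (fun i => if i == 0 then v else 0) (isT : 0 < 2)%N.
by rewrite !big_ord_recl big_ord0 /= mulr1 mul0r !addr0; exists w.
Qed.

Lemma closed_artin_schreier (k : closedFieldType) (a : k) :
  exists t, t ^+ 2 + t + a = 0.
Proof.
have [t] :=
  solve_monicpoly (fun i => if i == 0 then - a else - 1) (isT : 0 < 2)%N.
rewrite !big_ord_recl big_ord0 /= => Et.
by exists t; rewrite Et; ring.
Qed.

(** * Irreducibility *)

(** The hypotheses say that (p Y + q) (p' Y + q') is
    X^2 Y^2 + X^2 Y + (c + a X^2 + e X^4).  Since c is nonzero, q and q' do not
    vanish at 0, so X divides both p and p', and p = A X, p' = B X with A, B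
    constant.  The derivatives at 0 of A q' + B q = X and of q q' (whose
    derivative vanishes in characteristic 2) then contradict each other. *)
Lemma no_linear_splitting (k : fieldType) (hk : 2%N \in [pchar k]) (a c e : k)
    (p q p' q' : {poly k}) : c != 0 ->
  p * p' = 'X^2 -> p * q' + p' * q = 'X^2 ->
  q * q' = c%:P + a *: 'X^2 + e *: 'X^4 -> False.
Proof.
move=> c0 Epp Epq Eqq.
have two : 2%:R = 0 :> k := pcharf0 hk.
have E0 : q.[0] * q'.[0] = c.
  by rewrite -hornerM Eqq !hornerE /= ?expr0n ?(mulr0, addr0).
have dE0 : q^`().[0] * q'.[0] + q.[0] * q'^`().[0] = 0.
  rewrite -!hornerM -hornerD -derivM Eqq !derivE !hornerE /=.
  by rewrite ?expr0n ?mulr0 ?mul0rn ?addr0 ?mulr0.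
have q0 : q.[0] != 0 by apply: contra_neq c0 => h; rewrite -E0 h mul0r.
have q'0 : q'.[0] != 0 by apply: contra_neq c0 => h; rewrite -E0 h mulr0.
have hpp : p.[0] * p'.[0] = 0 by rewrite -hornerM Epp !hornerE ?expr0n.
have hpq : p.[0] * q'.[0] + p'.[0] * q.[0] = 0.
  by rewrite -!hornerM -hornerD Epq !hornerE ?expr0n.
have [p0 p'0] : p.[0] = 0 /\ p'.[0] = 0.
  move/eqP: hpp; rewrite mulf_eq0 => /orP[] /eqP h;
    move/eqP: hpq; rewrite h mul0r.
    by rewrite add0r mulf_eq0 (negPf q0) orbF => /eqP.
  by rewrite addr0 mulf_eq0 (negPf q'0) orbF => /eqP.
have [A EA] : exists A, p = A * 'X.
  have /factor_theorem[A ->] : root p 0 by apply/eqP.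
  by exists A; rewrite subr0.
have [B EB] : exists B, p' = B * 'X.
  have /factor_theorem[B ->] : root p' 0 by apply/eqP.
  by exists B; rewrite subr0.
have X0 : ('X : {poly k}) != 0 by rewrite polyX_eq0.
have EAB : A * B = 1.
  apply: (mulIf X0); apply: (mulIf X0).
  by rewrite mul1r -expr2 -Epp EA EB; ring.
have ELin : A * q' + B * q = 'X.
  by apply: (mulIf X0); rewrite -expr2 -Epq EA EB; ring.
have [al [be [EA' EB']]] : exists al be : k, A = al%:P /\ B = be%:P.
  have uA : A \is a GRing.unit by apply/unitrPr; exists B.
  have uB : B \is a GRing.unit by apply/unitrPr; exists A; rewrite mulrC.
  move: uA uB; rewrite !poly_unitE => /andP[/eqP sA _] /andP[/eqP sB _].
  by exists A`_0, B`_0; split; apply: size1_polyC; rewrite ?sA ?sB.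
have h2 : al * q'.[0] + be * q.[0] = 0.
  have := congr1 (horner^~ 0) ELin; rewrite EA' EB' /=.
  by rewrite !hornerE.
have h3 : al * q'^`().[0] + be * q^`().[0] = 1.
  have := congr1 (fun f => (deriv f).[0]) ELin; rewrite EA' EB' /=.
  by rewrite !derivE !hornerE /=.
have : q.[0] * q'.[0] * 1 = 0.
  rewrite -h3.
  have -> : q.[0] * q'.[0] * (al * q'^`().[0] + be * q^`().[0]) =
     (q^`().[0] * q'.[0] + q.[0] * q'^`().[0]) * (be * q.[0]) +
     q.[0] * q'^`().[0] * (al * q'.[0] + be * q.[0]) -
     2%:R * (q.[0] * q'^`().[0] * be * q.[0]) by ring.
  by rewrite h2 dE0 two !(mul0r, mulr0) subr0 addr0.
by rewrite mulr1 E0 => /eqP; rewrite (negPf c0).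
Qed.

(** The coordinates are nested so that u ([Z]) is innermost, x ([X]) is next and
    y is outermost.  [Z], [X] and [M] are variables with equations in order to
    keep the coefficients folded during rewriting. *)
Lemma conic_bundle_irreducible (k : fieldType) (hk : 2%N \in [pchar k])
   (a c e : k) (Z X M : {poly {poly k}}) (G H : {poly {poly {poly k}}}) :
  c != 0 -> Z = 'X%:P -> X = 'X ->
  M = c%:P%:P * X ^+ 4 + e%:P%:P * Z ^+ 4 + a%:P%:P * (Z * X) ^+ 2 ->
  M%:P + (Z ^+ 2 * X)%:P * 'X + (Z ^+ 2)%:P * 'X ^+ 2 = G * H ->
  G \is a GRing.unit \/ H \is a GRing.unit.
Proof.
move=> c0 EZ EX EM E.
have Z2 : Z ^+ 2 = ('X^2)%:P by rewrite EZ polyC_exp.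
have Z20 : Z ^+ 2 != 0 by rewrite Z2 polyC_eq0 expf_neq0 // polyX_eq0.
set F := _ + _ in E.
have EF : F = Poly [:: M; Z ^+ 2 * X; Z ^+ 2].
  by rewrite /F /= !cons_poly_def mul0r add0r; ring.
have sF : size F = 3%N.
  by rewrite EF (@PolyK _ 0) // (negPf Z20).
have cF i : F`_i = [:: M; Z ^+ 2 * X; Z ^+ 2]`_i.
  by rewrite EF coef_Poly.
have F0 : F != 0 by rewrite -size_poly_eq0 sF.
have [G0 H0] : G != 0 /\ H != 0 by apply/andP; rewrite -negb_or -mulf_eq0 -E.
have sGH : (size G + size H = 4)%N.
  have := size_mul G0 H0; rewrite -E sF => h.
  have : (0 < size G)%N by rewrite size_poly_gt0.
  by case: (size G) h => // n; rewrite addSn /= => <-.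
(* a factor of degree 0 in y divides Z^2, hence has degree 0 in X as well, and
   then divides c, the coefficient of X^4 in M *)
have deg0 G1 H1 : F = G1 * H1 -> size G1 = 1%N -> G1 \is a GRing.unit.
  move=> E1 /eqP s1; have [g g0 Eg] := size_poly1P _ s1.
  have c2 : g * H1`_2 = ('X^2)%:P by rewrite -coefCM -Eg -E1 cF /= Z2.
  have c00 : g * H1`_0 = M by rewrite -coefCM -Eg -E1 cF.
  have [g1 g10 Eg1] : exists2 g1, g1 != 0 & g = g1%:P.
    have h0 : H1`_2 != 0.
      by apply/eqP => h; move/eqP: c2; rewrite h mulr0 -Z2 eq_sym (negPf Z20).
    have := size_mul g0 h0; rewrite c2 size_polyC expf_neq0 ?polyX_eq0 //=.
    move=> h; apply/size_poly1P.
    have : (0 < size g)%N by rewrite size_poly_gt0.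
    have : (0 < size (H1`_2)%R)%N by rewrite size_poly_gt0.
    by case: (size g) h => // [] [|n] //; case: (size _) => // m;
      rewrite !addSn /= addnS.
  have : g1 * (H1`_0)`_4 = c%:P.
    have -> : g1 * (H1`_0)`_4 = M`_4 by rewrite -coefCM -Eg1 c00.
    have -> : M = c%:P%:P * 'X^4 + (e%:P * 'X^4)%:P + (a%:P * 'X^2)%:P * 'X^2.
      by rewrite EM EX EZ polyCM polyC_exp polyCM polyC_exp; ring.
    by rewrite !coefD !coefCM !coefXn coefC /= mulr1 mulr0 !addr0.
  move=> Ec; have ug1 : g1 \is a GRing.unit.
    apply/unitrPr; exists ((H1`_0)`_4 * c^-1%:P).
    by rewrite mulrA Ec -polyCM mulfV.
  by rewrite Eg Eg1; rewrite !rmorph_unit.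
have [sG|sG] := eqVneq (size G) 1%N; first by left; apply: deg0 E sG.
have [sH|sH] := eqVneq (size H) 1%N.
  by right; apply: deg0 sH; rewrite E mulrC.
have [s2G s2H] : (size G = 2 /\ size H = 2)%N.
  move: G0 H0 sG sH sGH; rewrite -!size_poly_gt0.
  by case: (size G) => [|[|[|[|n]]]] //; case: (size H) => [|[|[|[|m]]]] //;
    rewrite !addSn ?addnS.
(* two factors of degree 1 in y: specialize X to 1 *)
exfalso.
have c2G : G`_2 = 0 by apply: nth_default; rewrite s2G.
have c2H : H`_2 = 0 by apply: nth_default; rewrite s2H.
have := cF 0%N; have := cF 1%N; have := cF 2%N.
rewrite E !coefM !big_ord_recl !big_ord0 /= !subn0 /bump /= c2G c2H.
rewrite !(mul0r, mulr0, addr0, add0r) => E2 E1 E0.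
apply: (@no_linear_splitting k hk a c e (G`_1).[1] (G`_0).[1]
          (H`_1).[1] (H`_0).[1]) => //.
- by rewrite -hornerM E2 Z2 hornerC.
- rewrite -!hornerM -hornerD addrC [H`_1 * _]mulrC E1 Z2 EX.
  by rewrite hornerM hornerC hornerX mulr1.
- rewrite -hornerM E0 EM EX EZ.
  rewrite !(hornerD, horner_exp, hornerM, hornerC, hornerX).
  by rewrite -!mul_polyC; ring.
Qed.

(** The universal property of a polynomial ring. *)
Lemma poly_extend_morphism (R : nzRingType) (S : comNzRingType)
    (f : {rmorphism R -> S}) (u : S) :
  exists g : {rmorphism {poly R} -> S}, (forall x, g x%:P = f x) /\ g 'X = u.
Proof.
pose cfu : commr_rmorph f u := fun x => mulrC u (f x).
exists (horner_morph cfu).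
by split=> [x|]; [apply: horner_morphC | apply: horner_morphX].
Qed.

Section Irreducibility.
Variables (k : fieldType) (a b c e s r : k).
Hypothesis hk : 2%N \in [pchar k].
Hypotheses (hs : s ^+ 2 = b) (hr : r ^+ 2 = a).

Local Notation tower := {poly {poly {poly k}}}.
Definition const3 : k -> tower := polyC \o (polyC \o polyC).

(** The images of x, y and z; the last one is chosen so that z + s y + r s x,
    whose square is a factor of the second term of the quartic, becomes the
    innermost variable. *)
Definition tower_coord (i : 'I_3) : tower :=
  [:: 'X%:P; 'X; 'X%:P%:P + const3 s * 'X + const3 (r * s) * 'X%:P]`_i.

Definition to_tower : {mpoly k[3]} -> tower := mmap const3 tower_coord.

Lemma to_towerM : {morph to_tower : f g / f * g}.
Proof. exact: (rmorphM (mmap const3 tower_coord)). Qed.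

Lemma to_tower_unit f : f \is a GRing.unit -> to_tower f \is a GRing.unit.
Proof. exact: (rmorph_unit (mmap const3 tower_coord)). Qed.

(** [to_tower] has a left inverse, which is a ring morphism: it evaluates the
    innermost variable at z + s y + r s x. *)
Lemma to_tower_unit_reflect f :
  to_tower f \is a GRing.unit -> f \is a GRing.unit.
Proof.
pose X0 : {mpoly k[3]} := 'X_(@Ordinal 3 0 isT).
pose X1 : {mpoly k[3]} := 'X_(@Ordinal 3 1 isT).
pose X2 : {mpoly k[3]} := 'X_(@Ordinal 3 2 isT).
pose U := X2 + s%:MP * X1 + (r * s)%:MP * X0.
have [g1 [g1C g1X]] := poly_extend_morphism (@mpolyC 3 k) U.
have [g2 [g2C g2X]] := poly_extend_morphism g1 X0.
have [g [gP gX]] := poly_extend_morphism g2 X1.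
have gC x : g (const3 x) = x%:MP by rewrite gP g2C g1C.
have gh i : g (tower_coord i) = 'X_i.
  case: i => [[|[|[|i]]] hi] //;
    rewrite (bool_irrelevance hi isT) /tower_coord /=.
    by rewrite gP g2X.
  rewrite !rmorphD !rmorphM !gC !gP g2C g1X g2X gX.
  have kM : 2%N \in [pchar {mpoly k[3]}] by apply: (rmorph_pchar (@mpolyC 3 k)).
  apply: (eq_pchar2 kM (t := s%:MP * X1 + (r%:MP * s%:MP) * X0)).
  by rewrite /U /X2 !mpolyCM; ring.
have gK : cancel to_tower g.
  move=> p; rewrite {2}[p]mpolyE /to_tower /mmap rmorph_sum.
  apply: eq_bigr => m _; rewrite rmorphM gC mul_mpolyC; congr (_ *: _).
  rewrite /mmap1 rmorph_prod mpolyXE_id; apply: eq_bigr => i _.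
  by rewrite rmorphXn gh.
by move=> uf; rewrite -(gK f) rmorph_unit.
Qed.

Lemma to_tower_quartic (Z X : {poly {poly k}}) : Z = 'X%:P -> X = 'X ->
  to_tower (quartic a b c e) =
  (c%:P%:P * X ^+ 4 + e%:P%:P * Z ^+ 4 + a%:P%:P * (Z * X) ^+ 2)%:P
    + (Z ^+ 2 * X)%:P * 'X + (Z ^+ 2)%:P * 'X ^+ 2.
Proof.
move=> EZ EX; rewrite /to_tower /quartic.
have fM : {morph mmap const3 tower_coord : f g / f * g} := rmorphM _.
have fX n : {morph mmap const3 tower_coord : f / f ^+ n} := rmorphXn _ n.
rewrite !(mmapD, fX, fM, mmapZ, mmapX, mmap1U) /tower_coord /=.
have kT : 2%N \in [pchar tower] by rewrite !pchar_poly.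
rewrite -EZ -EX -hs /const3 /=.
have -> : (Z%:P + s%:P%:P%:P * 'X + (r * s)%:P%:P%:P * X%:P) ^+ 2
   + (s ^+ 2)%:P%:P%:P * 'X ^+ 2 + (a * s ^+ 2)%:P%:P%:P * X%:P ^+ 2
   = Z%:P ^+ 2.
  rewrite -hr !polyC_exp !polyCM ?polyC_exp.
  move: (s%:P%:P%:P) (r%:P%:P%:P) => s' r'.
  by apply: (eq_pchar2 kT (t := s' ^+ 2 * 'X ^+ 2
    + r' ^+ 2 * s' ^+ 2 * X%:P ^+ 2 + Z%:P * s' * 'X + Z%:P * r' * s' * X%:P + s' * 'X * r' * s' * X%:P)); ring.
clear EX EZ; rewrite !polyCD !polyCM; ring.
Qed.

Lemma quartic_irreducible : c != 0 -> irreducible_form (quartic a b c e).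
Proof.
move=> c0.
have EQ := to_tower_quartic erefl erefl.
set F := (X in _ = X) in EQ.
have sF : (1 < size F)%N.
  rewrite ltnNge; apply/negP => /leq_sizeP /(_ 2%N isT).
  rewrite /F !coefD !coefCM coefX coefXn coefC /= mulr0 !add0r mulr1.
  by move/eqP; rewrite expf_eq0 /= polyC_eq0 polyX_eq0.
split.
- apply/eqP => Q0; move: sF; rewrite -EQ Q0 /to_tower mmap0 size_poly0 //.
- apply/negP => /to_tower_unit; rewrite EQ poly_unitE => /andP[/eqP s1 _].
  by rewrite s1 in sF.
move=> G H EGH.
have E : F = to_tower G * to_tower H by rewrite -to_towerM -EGH.
by case: (conic_bundle_irreducible hk c0 erefl erefl erefl E)
  => /to_tower_unit_reflect; [left|right].
Qed.

Lemma quartic_homog : quartic a b c e \is 4.-homog.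
Proof.
have hX i : ('X_i : {mpoly k[3]}) \is 1.-homog.
  by rewrite dhomogX; apply/eqP; apply: mdeg1.
have hX2 i : ('X_i : {mpoly k[3]}) ^+ 2 \is 2.-homog := dhomogMn 2 (hX i).
have hX4 i : ('X_i : {mpoly k[3]}) ^+ 4 \is 4.-homog := dhomogMn 4 (hX i).
rewrite /quartic; apply: rpredD; first exact: rpredZ.
apply: (@dhomogM _ _ _ 2 _ 2); rewrite !(rpredD, rpredZ) //.
exact: (@dhomogM _ _ _ 1 _ 1).
Qed.
End Irreducibility.

(** * Coordinates of points and lines *)

Section Points.
Variable k : fieldType.
Implicit Types (x y z t l m n : k) (P R : 'rV[k]_3).

Lemma pt_coord P : exists x y z, P = pt x y z.
Proof.
exists (P 0 0), (P 0 1), (P 0 (@Ordinal 3 2 isT)).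
apply/rowP=> i; rewrite mxE; case: i => [[|[|[|i]]] hi] //=;
  congr (P _ _); exact: val_inj.
Qed.

Lemma pt_inj x y z x' y' z' :
  pt x y z = pt x' y' z' -> [/\ x = x', y = y' & z = z'].
Proof.
move/rowP=> h; have := h (@Ordinal 3 0 isT); have := h (@Ordinal 3 1 isT).
by have := h (@Ordinal 3 2 isT); rewrite !mxE.
Qed.

Lemma scale_pt t x y z : t *: pt x y z = pt (t * x) (t * y) (t * z).
Proof. by apply/rowP=> i; rewrite !mxE; case: i => [[|[|[|i]]] hi]. Qed.

Lemma pt_eq0 x y z : (pt x y z == 0) = [&& x == 0, y == 0 & z == 0].
Proof.
have -> : 0 = pt 0 0 0 :> 'rV[k]_3.
  by rewrite -(scale0r (pt 0 0 0)) scale_pt !mul0r.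
apply/eqP/and3P => [/pt_inj[-> -> ->] //|[/eqP-> /eqP-> /eqP->] //].
Qed.

Lemma mul_pt_tr x y z l m n :
  pt x y z *m (pt l m n)^T = (x * l + y * m + z * n)%:M.
Proof.
apply/matrixP=> i j; rewrite !ord1 !mxE !big_ord_recl big_ord0 !mxE /=.
by rewrite addr0 addrA.
Qed.

Lemma on_line_pt x y z l m n :
  on_line (pt l m n) (pt x y z) = (x * l + y * m + z * n == 0).
Proof.
rewrite /on_line mul_pt_tr; apply/eqP/eqP => [/matrixP/(_ 0 0)|->].
  by rewrite !mxE.
by rewrite -scalemx1 scale0r.
Qed.

Lemma same_pointP P R : P != 0 ->
  reflect (exists2 t, t != 0 & P = t *: R) (P == R)%MS.
Proof.
move=> P0; apply: (iffP idP) => [/andP[/sub_rVP[t Et] _]|[t t0 ->]].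
  by exists t => //; apply: contra_neq P0 => t0; rewrite Et t0 scale0r.
by apply/eqmxP; apply: eqmx_scale.
Qed.

(** Makes (0 : 0 : 1) available as the second point on a tangent in
    [mult_ge]. *)
Lemma row_free_pt001 x y z :
  (x != 0) || (y != 0) -> row_free (col_mx (pt x y z) (pt 0 0 1)).
Proof.
move=> xy0.
have [l [m Elm]] : exists l m, x * l + y * m = 1.
  case/orP: xy0 => h0; first by exists x^-1, 0; rewrite mulr0 addr0 mulfV.
  by exists 0, y^-1; rewrite mulr0 add0r mulfV.
apply/row_freeP; exists (row_mx (pt l m 0)^T (pt (- z * l) (- z * m) 1)^T).
rewrite mul_col_row !mul_pt_tr !(mul0r, mulr0, mul1r, mulr1, addr0, add0r) Elm.
have -> : x * (- z * l) + y * (- z * m) + z = z * (1 - (x * l + y * m)) by ring.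
rewrite Elm subrr mulr0 scalar_mx_block.
by congr block_mx; rewrite -scalemx1 scale0r.
Qed.

End Points.

(** * Tangents and inflection points *)

Section Curve.
Variables (k : fieldType) (a b c e s r : k).
Hypothesis hk : 2%N \in [pchar k].
Hypotheses (hc : c != 0) (he : e != 0) (hs : s ^+ 2 = b) (hr : r ^+ 2 = a).
Implicit Types (x y z t : k).

(** Square root of the form z^2 + b y^2 + a b x^2 ([qroot_sqr]). *)
Definition qroot x y z := z + s * y + r * s * x.
Definition conic x y := y ^+ 2 + x * y + a * x ^+ 2.
Definition quartic_val x y z :=
  c * x ^+ 4 + qroot x y z ^+ 2 * (e * qroot x y z ^+ 2 + conic x y).

Local Notation Q := (quartic a b c e).
Local Notation u := qroot.
Local Notation N := conic.
Local Notation F := quartic_val.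

Lemma qroot_sqr x y z : u x y z ^+ 2 = z ^+ 2 + b * y ^+ 2 + a * b * x ^+ 2.
Proof.
rewrite /qroot -hs -hr.
apply: (eq_pchar2 hk (t := z * s * y + z * r * s * x + s * y * r * s * x)).
by ring.
Qed.

Lemma quartic_eval x y z : Q.@[pt x y z 0] = F x y z.
Proof.
rewrite /quartic /quartic_val qroot_sqr /conic.
by rewrite !(mevalD, mevalM, mevalZ, rmorphXn, mevalXU) /= !mxE.
Qed.

(** Squares have zero derivative, so only the term u^2 x y contributes. *)
Lemma gradient_quartic x y z :
  gradient Q (pt x y z) = u x y z ^+ 2 *: pt y x 0.
Proof.
have k2 : 2%:R = 0 :> k := pcharf0 hk.
have D2 (i : 'I_3) (f : {mpoly k[3]}) : (f ^+ 2)^`M(i) = 0.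
  rewrite expr2 mderivM mulrC -mulr2n -scaler_nat k2 scale0r //.
have D4 (i : 'I_3) (f : {mpoly k[3]}) : (f ^+ 4)^`M(i) = 0.
  by rewrite (exprM f 2 2) D2.
have DX (i j : 'I_3) : ('X_j : {mpoly k[3]})^`M(i) = (i == j)%:R.
  rewrite mderivX mnmE eq_sym; case: eqP => [->|_]; last by rewrite scale0r.
  by rewrite scale1r -{1}[U_(j)%MM]add0m addmK mpolyX0.
rewrite scale_pt /quartic; apply/rowP=> i; rewrite !mxE qroot_sqr.
rewrite !(mderivD, mderivM, mderivZ, D2, D4).
rewrite !(scaler0, addr0, add0r, mulr0, mul0r).
rewrite !DX !(mevalM, mevalD, mevalZ, rmorphXn, mevalXU, rmorph_nat) /= !mxE /=.
by case: i => [[|[|[|i]]] hi] //=;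
  rewrite ?(mul0r, mulr0, mulr1, mul1r, addr0, add0r).
Qed.

(** By additivity of squaring, u^2 and x^4 restrict to u(P)^2 + u(R)^2 t^2 and
    x(P)^4 + x(R)^4 t^4.  The hypothesis is that the polar form of N vanishes
    on the two points, so that N restricts to N(P) + N(R) t^2. *)
Lemma restrict_quartic x y z x' y' z' : x * y' + x' * y = 0 ->
  restrict_to_line Q (pt x y z) (pt x' y' z') =
  (F x y z)%:P +
  (u x y z ^+ 2 * N x' y' + u x' y' z' ^+ 2 * N x y)%:P * 'X^2 +
  (F x' y' z')%:P * 'X^4.
Proof.
move=> tg.
have k2 : 2%:R = 0 :> k := pcharf0 hk.
have kX : 2%N \in [pchar {poly k}] by rewrite pchar_poly.
rewrite /restrict_to_line /quartic.
set h := fun i => _.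
have fM : {morph mmap polyC h : f g / f * g} := rmorphM _.
have fX n : {morph mmap polyC h : f / f ^+ n} := rmorphXn _ n.
rewrite !(mmapD, fX, fM, mmapZ, mmapX, mmap1U) /h !mxE /=.
rewrite -!mul_polyC.
have -> : (z%:P + z'%:P * 'X) ^+ 2 + b%:P * (y%:P + y'%:P * 'X) ^+ 2 +
   (a * b)%:P * (x%:P + x'%:P * 'X) ^+ 2 =
   (u x y z ^+ 2)%:P + (u x' y' z' ^+ 2)%:P * 'X^2.
  rewrite !qroot_sqr !(polyCD, polyCM, polyC_exp).
  apply: (eq_pchar2 kX (t := z%:P * z'%:P * 'X + b%:P * y%:P * y'%:P * 'X
    + a%:P * b%:P * x%:P * x'%:P * 'X)); ring.
have -> : (y%:P + y'%:P * 'X) ^+ 2 + (x%:P + x'%:P * 'X) * (y%:P + y'%:P * 'X)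
  + a%:P * (x%:P + x'%:P * 'X) ^+ 2 = (N x y)%:P + (N x' y')%:P * 'X^2.
  (* the coefficient of 'X vanishes by the hypothesis on the two points *)
  rewrite -[RHS]addr0 -[0 in RHS](mul0r 'X) -polyC0 -tg /conic.
  rewrite !(polyCD, polyCM, polyC_exp).
  apply: (eq_pchar2 kX (t := y%:P * y'%:P * 'X + a%:P * x%:P * x'%:P * 'X)).
  by ring.
rewrite /quartic_val.
move: (u x y z) (u x' y' z') (N x y) (N x' y') => v v' n n'.
rewrite !(polyCD, polyCM, polyC_exp).
apply: (eq_pchar2 kX (t := c%:P * (x%:P ^+ 3 * x'%:P * 'X * 2%:R
  + 3%:R * x%:P ^+ 2 * x'%:P ^+ 2 * 'X ^+ 2
  + 2%:R * x%:P * x'%:P ^+ 3 * 'X ^+ 3)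
  + e%:P * v%:P ^+ 2 * v'%:P ^+ 2 * 'X^2)); ring.
Qed.

Lemma on_curve_pt x y z :
  on_curve Q (pt x y z) = [|| x != 0, y != 0 | z != 0] && (F x y z == 0).
Proof. by rewrite /on_curve pt_eq0 !negb_and quartic_eval. Qed.

Lemma gradient_eq0 x y z :
  (gradient Q (pt x y z) == 0) = (u x y z == 0) || (x == 0) && (y == 0).
Proof.
rewrite gradient_quartic scaler_eq0 pt_eq0 expf_eq0 /= eqxx andbT.
by rewrite [(y == 0) && _]andbC.
Qed.

Lemma smooth_pt x y z : smooth_point Q (pt x y z) =
  [&& F x y z == 0, u x y z != 0 & (x != 0) || (y != 0)].
Proof.
rewrite /smooth_point on_curve_pt gradient_eq0 negb_or negb_and.
by case: (x == 0); case: (y == 0); case: (z == 0); case: (F _ _ _ == 0);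
  case: (u _ _ _ == 0).
Qed.

Lemma singular_pt x y z : singular_point Q (pt x y z) <->
  [/\ x = 0, y != 0 & z = s * y].
Proof.
have two : forall v : k, v + v = 0 by move=> v; exact: addrr_pchar2.
rewrite /singular_point on_curve_pt gradient_eq0; split; last first.
  move=> [-> y0 ->]; rewrite y0 orbT /quartic_val /qroot mulr0 addr0 two.
  by rewrite !expr0n !mul0r mulr0 addr0 eqxx.
case/andP=> /andP[P0 /eqP F0] /orP[/eqP u0|/andP[/eqP x0 /eqP y0]]; last first.
  have /eqP : e * z ^+ 4 = 0.
    by rewrite -F0 x0 y0 /quartic_val /qroot /conic; ring.
  rewrite mulf_eq0 (negPf he) expf_eq0 /= => /eqP z0.
  by move: P0; rewrite x0 y0 z0 eqxx.
have x0 : x = 0.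
  move/eqP: F0; rewrite /quartic_val u0 expr0n /= mul0r addr0.
  by rewrite mulf_eq0 (negPf hc) expf_eq0 => /eqP.
move: u0; rewrite /qroot x0 mulr0 addr0 => zy.
have Ez : z = s * y by rewrite -[z]addr0 -(two (s * y)) addrA zy add0r.
split=> //; apply: contraTneq P0 => y0.
by rewrite x0 Ez y0 mulr0 eqxx.
Qed.

Lemma tangent_through_001 P : on_line (tangent_line Q P) (pt 0 0 1).
Proof.
have [x [y [z ->]]] := pt_coord P.
rewrite /tangent_line gradient_quartic // scale_pt on_line_pt.
by rewrite !mulr0 !mul0r !addr0.
Qed.

Lemma on_tangent_pt x y z x' y' z' : u x y z != 0 ->
  on_line (tangent_line Q (pt x y z)) (pt x' y' z') = (x' * y + y' * x == 0).
Proof.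
move=> u0; rewrite /tangent_line gradient_quartic // scale_pt on_line_pt.
have -> : x' * (u x y z ^+ 2 * y) + y' * (u x y z ^+ 2 * x)
    + z' * (u x y z ^+ 2 * 0) = u x y z ^+ 2 * (x' * y + y' * x) by ring.
by rewrite mulf_eq0 expf_eq0 (negPf u0).
Qed.

Lemma restrict_tangent x y z x' y' z' : u x y z != 0 -> F x y z = 0 ->
  on_line (tangent_line Q (pt x y z)) (pt x' y' z') ->
  restrict_to_line Q (pt x y z) (pt x' y' z') =
  (u x y z ^+ 2 * N x' y' + u x' y' z' ^+ 2 * N x y)%:P * 'X^2
  + (F x' y' z')%:P * 'X^4.
Proof.
move=> u0 F0; rewrite on_tangent_pt // => /eqP tg.
rewrite restrict_quartic ?F0 ?add0r // -tg; ring.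
Qed.

Lemma quartic_val_001 : F 0 0 1 = e.
Proof. by rewrite /quartic_val /qroot /conic; ring. Qed.

Lemma restrict_tangent_vertical x y z : u x y z != 0 -> F x y z = 0 ->
  restrict_to_line Q (pt x y z) (pt 0 0 1) = (N x y)%:P * 'X^2 + e%:P * 'X^4.
Proof.
move=> u0 F0; rewrite restrict_tangent //; last exact: tangent_through_001.
rewrite quartic_val_001; congr (_%:P * _ + _); rewrite /qroot /conic; ring.
Qed.

(** Reads off the multiplicity of the tangent at its point of contact: below 3
    unless f = 0, and always below 5. *)
Lemma dvdXn_biquadratic (f g : k) : g != 0 ->
  [/\ 'X^3 %| f%:P * 'X^2 + g%:P * 'X^4 -> f = 0 &
      ~~ ('X^5 %| f%:P * 'X^2 + g%:P * 'X^4)].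
Proof.
move=> g0; split.
  move=> /dvdpP[h E]; have := congr1 (fun p : {poly k} => p`_2) E.
  by rewrite coefMXn /= coefD !coefCM !coefXn /= mulr1 mulr0 addr0.
apply/negP => /dvdpP[h E]; have := congr1 (fun p : {poly k} => p`_4) E.
rewrite coefMXn /= coefD !coefCM !coefXn /= mulr1 mulr0 add0r => /eqP.
by rewrite (negPf g0).
Qed.

Lemma inflection_conic x y z :
  inflection_point Q (pt x y z) -> N x y = 0.
Proof.
case; rewrite smooth_pt => /and3P[/eqP F0 u0 xy0] /(_ (pt 0 0 1)).
move/(_ (tangent_through_001 _) (row_free_pt001 _ xy0)).
rewrite restrict_tangent_vertical //.
by case: (dvdXn_biquadratic (N x y) he).
Qed.

(** If N = 0, then F = c x^4 + e u^4, so x = 0 iff u = 0; and x = 0 implies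
    y = 0, after which u = 0 gives z = 0. *)
Lemma smooth_conic x y z :
  on_curve Q (pt x y z) -> N x y = 0 -> smooth_point Q (pt x y z).
Proof.
rewrite on_curve_pt smooth_pt => /andP[P0 /eqP F0] N0; rewrite F0 eqxx /=.
have xy0 : (x == 0) -> (y == 0).
  move=> /eqP x0; move/eqP: N0.
  by rewrite /conic x0 mul0r expr0n mulr0 !addr0 expf_eq0.
have u0 : (u x y z == 0) = (x == 0).
  apply/eqP/eqP => h0.
    move/eqP: F0; rewrite /quartic_val h0 expr0n /= mul0r addr0.
    by rewrite mulf_eq0 (negPf hc) expf_eq0 => /eqP.
  move/eqP: F0; rewrite /quartic_val N0 h0 expr0n /= mulr0 add0r addr0.
  by rewrite mulrCA -exprD mulf_eq0 (negPf he) expf_eq0 => /eqP.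
have x0 : x != 0.
  apply: contraTneq P0 => x0; have /eqP y0 := xy0 (introT eqP x0).
  have /eqP : u x y z = 0 by apply/eqP; rewrite u0 x0.
  by rewrite /qroot x0 y0 !mulr0 !addr0 => /eqP->; rewrite eqxx.
by rewrite u0 x0.
Qed.

Lemma conic_x_neq0 x y : (x != 0) || (y != 0) -> N x y = 0 -> x != 0.
Proof.
move=> xy0 N0; apply: contraTneq xy0 => x0; move/eqP: N0.
rewrite /conic x0 mul0r expr0n mulr0 !addr0 expf_eq0 eqxx /= => /eqP->.
by rewrite eqxx.
Qed.

(** Any R on the tangent has the same ratio y/x as P (or x = y = 0), so N(R) = 0
    as well and only the term F(R) t^4 remains. *)
Lemma mult_ge4_conic x y z : smooth_point Q (pt x y z) -> N x y = 0 ->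
  mult_ge Q (tangent_line Q (pt x y z)) (pt x y z) 4.
Proof.
rewrite smooth_pt => /and3P[/eqP F0 u0 xy0] N0 R.
have [x' [y' [z' ->]]] := pt_coord R.
move=> tg _; rewrite restrict_tangent // N0 mulr0 addr0.
have x0 := conic_x_neq0 xy0 N0.
have -> : N x' y' = 0.
  apply: (mulfI (expf_neq0 2 x0)); rewrite mulr0.
  move: tg; rewrite on_tangent_pt // => /eqP tg.
  have -> : x ^+ 2 * N x' y' = x' ^+ 2 * N x y +
     (x' * y + y' * x) * (y' * x + x' * x - x' * y).
    by apply: (eq_pchar2 hk (t := - (x * x' ^+ 2 * y))); rewrite /conic; ring.
  by rewrite N0 tg mulr0 mul0r addr0.
by rewrite mulr0 polyC0 mul0r add0r dvdp_mull.
Qed.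

Lemma nonordinaryP x y z : nonordinary_inflection_point Q (pt x y z) <->
  on_curve Q (pt x y z) /\ N x y = 0.
Proof.
split=> [[infl _]|[onc N0]].
  by split; [case: infl => /andP[] | apply: inflection_conic infl].
have sm := smooth_conic onc N0.
have m4 := mult_ge4_conic sm N0.
split; last split=> //.
  split=> // R tg fr; apply: dvdp_trans (m4 R tg fr).
  by rewrite dvdp_exp2l.
move: (sm); rewrite smooth_pt => /and3P[/eqP F0 u0 xy0] /(_ (pt 0 0 1)).
move/(_ (tangent_through_001 _) (row_free_pt001 _ xy0)).
rewrite restrict_tangent_vertical //.
by apply/negP; case: (dvdXn_biquadratic (N x y) he).
Qed.

Lemma no_ordinary P : ~ ordinary_inflection_point Q P.
Proof.
have [x [y [z ->]]] := pt_coord P.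
case=> infl [_]; apply; apply: mult_ge4_conic (inflection_conic infl).
by case: infl.
Qed.

Lemma quartic_val_scale t x y z : F (t * x) (t * y) (t * z) = t ^+ 4 * F x y z.
Proof. rewrite /quartic_val /qroot /conic; ring. Qed.

Lemma conic_scale t x y : N (t * x) (t * y) = t ^+ 2 * N x y.
Proof. rewrite /conic; ring. Qed.

Lemma nonordinary_scale t P : t != 0 ->
  nonordinary_inflection_point Q P -> nonordinary_inflection_point Q (t *: P).
Proof.
have [x [y [z ->]]] := pt_coord P.
move=> t0; rewrite scale_pt !nonordinaryP !on_curve_pt.
move=> -[/andP[P0 /eqP F0] N0].
rewrite !mulf_eq0 (negPf t0) /= P0.
by rewrite quartic_val_scale conic_scale F0 N0 !mulr0 eqxx.
Qed.

Lemma same_tangent x y z z' : u x y z != 0 -> u x y z' != 0 ->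
  (tangent_line Q (pt x y z) == tangent_line Q (pt x y z'))%MS.
Proof.
move=> u0 u1; rewrite /tangent_line !gradient_quartic.
apply/eqmxP; apply: eqmx_trans (eqmx_scale _ _) (eqmx_sym (eqmx_scale _ _));
  by rewrite expf_neq0.
Qed.

(** The second point of contact is (x : y : z + d).  Since e d^2 = N, the factor
    e u^2 + N of the second term of F is e (u^2 + d^2), and adding d to z
    replaces u^2 by u^2 + d^2: up to e, the two factors are exchanged. *)
Lemma tangent_bitangent x y z d : e * d ^+ 2 = N x y -> x != 0 ->
  smooth_point Q (pt x y z) -> bitangent Q (tangent_line Q (pt x y z)).
Proof.
move=> Ed x0 sm; move: (sm); rewrite smooth_pt => /and3P[/eqP F0 u0 _].
have Eu : u x y (z + d) ^+ 2 = u x y z ^+ 2 + d ^+ 2.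
  apply: (eq_pchar2 hk (t := d * (z + s * y + r * s * x))).
  by rewrite /qroot; ring.
have Eq : F x y (z + d) = 0.
  rewrite -F0 /quartic_val Eu -Ed.
  apply: (eq_pchar2 hk (t := e * d ^+ 2 * u x y z ^+ 2 + e * d ^+ 4)); ring.
have u1 : u x y (z + d) != 0.
  apply: contra_eq_neq Eq => u1; rewrite /quartic_val u1 expr0n mul0r addr0.
  by rewrite mulf_neq0 ?expf_neq0.
exists (pt x y z), (pt x y (z + d)); split.
- by rewrite /tangent_at sm; apply/eqmxP.
- by rewrite /tangent_at smooth_pt Eq eqxx u1 x0 same_tangent.
case/same_pointP; first by rewrite pt_eq0 (negPf x0).
move=> t t0; rewrite scale_pt => /pt_inj[Ex _ Ez].
have t1 : t = 1 by apply: (mulIf x0); rewrite mul1r.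
apply/nonordinaryP; split; first by case/andP: sm.
move: Ez; rewrite t1 mul1r -[LHS]addr0 => /addrI d0.
by rewrite -Ed -d0 expr0n mulr0.
Qed.

(** With N = 0 the equation is c x^4 + e u^4 = 0, and fourth roots are unique in
    characteristic 2. *)
Lemma conic_fiber x y z z' : N x y = 0 -> F x y z = 0 -> F x y z' = 0 -> z = z'.
Proof.
rewrite /quartic_val => ->; rewrite !addr0 => F0 F0'.
have /eqP : e * (u x y z - u x y z') ^+ 4 = 0.
  rewrite -[RHS](subrr 0) -{1}F0 -F0'.
  move: (u x y z) (u x y z') => v v'.
  apply: (eq_pchar2 hk (t := e * (v' ^+ 4 - 2%:R * v ^+ 3 * v'
    + 3%:R * v ^+ 2 * v' ^+ 2 - 2%:R * v * v' ^+ 3))); ring.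
rewrite mulf_eq0 (negPf he) expf_eq0 subr_eq0 /= => /eqP.
by rewrite /qroot => /addIr /addIr.
Qed.

Lemma conic_point_unique t x y z z' : t != 0 -> x != 0 -> N x y = 0 ->
  F x y z = 0 -> F (t * x) (t * y) z' = 0 ->
  (pt (t * x) (t * y) z' == pt x y z)%MS.
Proof.
move=> t0 x0 N0 F0 F0'.
apply/same_pointP; first by rewrite pt_eq0 mulf_eq0 (negPf t0) (negPf x0).
exists t => //; rewrite scale_pt; congr pt.
apply: conic_fiber F0' _; rewrite ?conic_scale ?quartic_val_scale.
  by rewrite N0 mulr0.
by rewrite F0 mulr0.
Qed.

(** Proportional tangents mean proportional (x, y), hence N = 0 at both points,
    and [conic_fiber] determines z. *)
Lemma nonordinary_tangency x y z P :
  nonordinary_inflection_point Q (pt x y z) ->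
  tangent_at Q (tangent_line Q (pt x y z)) P -> (P == pt x y z)%MS.
Proof.
move=> inf; have [onc N0] := (nonordinaryP _ _ _).1 inf.
have sm : smooth_point Q (pt x y z) by case: inf => -[].
move: (sm); rewrite smooth_pt => /and3P[/eqP F0 u0 xy0].
have x0 := conic_x_neq0 xy0 N0.
have [x' [y' [z' ->]]] := pt_coord P.
rewrite /tangent_at smooth_pt => /andP[/and3P[/eqP F0' u0' _]].
rewrite /tangent_line !gradient_quartic !scale_pt.
case/same_pointP; first
  by rewrite pt_eq0 !negb_and (mulf_neq0 (expf_neq0 2 u0) x0) orbT.
move=> t t0; rewrite scale_pt => /pt_inj[Ey Ex _].
(* (x', y') = v (x, y), by comparing the two gradients *)
pose v := u x y z ^+ 2 / (t * u x' y' z' ^+ 2).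
have w0 : t * u x' y' z' ^+ 2 != 0 by rewrite mulf_neq0 ?expf_neq0.
have vw : t * u x' y' z' ^+ 2 * v = u x y z ^+ 2 by rewrite mulrC divfK.
have Ex' : x' = v * x by apply: (mulfI w0); rewrite [RHS]mulrA vw Ex [RHS]mulrA.
have Ey' : y' = v * y by apply: (mulfI w0); rewrite [RHS]mulrA vw Ey [RHS]mulrA.
rewrite Ex' Ey' in F0' *.
apply: conic_point_unique F0 F0' => //.
by rewrite mulf_neq0 ?invr_neq0 ?expf_neq0.
Qed.

Lemma singular_pointP P : singular_point Q P <-> (P == pt 0 1 s)%MS.
Proof.
have [x [y [z ->]]] := pt_coord P; rewrite singular_pt; split.
  case=> -> y0 ->; apply/same_pointP; first by rewrite pt_eq0 (negPf y0) andbF.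
  by exists y => //; rewrite scale_pt mulr0 mulr1 mulrC.
case/andP=> /sub_rVP[t]; rewrite scale_pt mulr0 mulr1 => /pt_inj[-> -> ->] h.
split; rewrite ?[s * _]mulrC //; apply: contraTneq h => ->.
have -> : pt 0 0 (0 * s) = 0 by rewrite mul0r; apply/eqP; rewrite pt_eq0 eqxx.
by apply/negP => /submx0null /eqP; rewrite pt_eq0 oner_eq0 andbF.
Qed.

(** At a point with x = 0 the tangent is the line x = 0, which contains
    (0 : 1 : s). *)
Lemma tangent_dichotomy x y z d : e * d ^+ 2 = N x y ->
  smooth_point Q (pt x y z) ->
  bitangent Q (tangent_line Q (pt x y z)) \/
  on_line (tangent_line Q (pt x y z)) (pt 0 1 s).
Proof.
move=> Ed sm; have [x0|x0] := eqVneq x 0; last first.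
  by left; apply: tangent_bitangent Ed x0 sm.
right; move: sm; rewrite smooth_pt => /and3P[_ u0 _].
by rewrite on_tangent_pt // x0 mul0r mulr0 addr0.
Qed.

Lemma nonordinary_tangent_at P : nonordinary_inflection_point Q P ->
  tangent_at Q (tangent_line Q P) P.
Proof. by case=> -[sm _] _; rewrite /tangent_at sm; apply/eqmxP. Qed.

Lemma nonordinary_unique_tangencyP P : nonordinary_inflection_point Q P <->
  exists l, [/\ bitangent Q l, tangent_at Q l P &
     forall P', tangent_at Q l P' -> (P' == P)%MS].
Proof.
split=> [inf|[l [[P1 [P2 [tg1 tg2 coinc]]] tgP uniqP]]].
  have tg := nonordinary_tangent_at inf; exists (tangent_line Q P); split=> //.
    by exists P, P.
  move: inf; have [x [y [z ->]]] := pt_coord P => inf P'.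
  exact: nonordinary_tangency.
(* the two points of contact of l both equal P, hence coincide *)
have sameP := uniqP _ tg1.
have inf1 : nonordinary_inflection_point Q P1.
  apply: coinc; apply/eqmxP.
  by apply: eqmx_trans (eqmxP sameP) (eqmx_sym (eqmxP (uniqP _ tg2))).
have : (P == P1)%MS by apply/eqmxP; apply: eqmx_sym; apply/eqmxP.
case/same_pointP => [|t t0 ->]; last exact: nonordinary_scale.
by case/andP: tgP => /andP[/andP[]].
Qed.

Lemma two_nonordinary t v : t ^+ 2 + t + a = 0 -> c + e * v ^+ 4 = 0 ->
  exists P1 P2 : 'rV[k]_3,
     [/\ ~ (P1 == P2)%MS,
         nonordinary_inflection_point Q P1,
         nonordinary_inflection_point Q P2 &
         forall P : 'rV[k]_3, nonordinary_inflection_point Q P ->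
           (P == P1)%MS \/ (P == P2)%MS].
Proof.
move=> Et Ev.
(* the z-coordinate for which u = v at x = 1; along with t, t + 1 is a root *)
pose w y := v - s * y - r * s.
have N1 : N 1 t = 0 by rewrite -Et /conic; ring.
have N2 : N 1 (t + 1) = 0.
  by rewrite -Et /conic; apply: (eq_pchar2 hk (t := t + 1)); ring.
have Fw y : N 1 y = 0 -> F 1 y (w y) = 0.
  by rewrite /quartic_val /qroot /w => ->; rewrite -[RHS]Ev; ring.
have infw y : N 1 y = 0 -> nonordinary_inflection_point Q (pt 1 y (w y)).
  by move=> Ny; apply/nonordinaryP; rewrite on_curve_pt oner_eq0 Fw // eqxx.
exists (pt 1 t (w t)), (pt 1 (t + 1) (w (t + 1))); split; try exact: infw.
  case/same_pointP; first by rewrite pt_eq0 oner_eq0.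
  move=> m _; rewrite scale_pt mulr1 => /pt_inj[<- + _].
  by rewrite mul1r -[LHS]addr0 => /addrI /esym /eqP; rewrite oner_eq0.
move=> P; have [x [y [z ->]]] := pt_coord P => inf.
have [onc Nxy] := (nonordinaryP _ _ _).1 inf.
have x0 : x != 0.
  case: inf => -[+ _] _; rewrite smooth_pt => /and3P[_ _ xy0].
  exact: conic_x_neq0 xy0 Nxy.
have Fxyz : F x y z = 0 by move: onc; rewrite on_curve_pt => /andP[_ /eqP].
have /eqP : (y - x * t) * (y - x * (t + 1)) = 0.
  transitivity (N x y + x ^+ 2 * (t ^+ 2 + t + a)).
    apply: (eq_pchar2 hk (t := - x * y * t - x * y - a * x ^+ 2)).
    by rewrite /conic; ring.
  by rewrite Nxy Et mulr0 addr0.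
rewrite mulf_eq0 !subr_eq0.
have uniq y' : N 1 y' = 0 -> y = x * y' -> (pt x y z == pt 1 y' (w y'))%MS.
  move=> Ny Ey.
  have := conic_point_unique x0 (oner_neq0 _) Ny (Fw _ Ny) (z' := z).
  by rewrite mulr1 -Ey; apply.
by case/orP=> /eqP Ey; [left|right]; apply: uniq.
Qed.

End Curve.

Theorem mainTheorem5 (k : closedFieldType) (hk : 2%N \in [pchar k])
    (a b c e s : k) (hce : c * e != 0) (hs : s ^+ 2 = b) :
  let Q := quartic a b c e in
  (* Q is an integral quartic with unique singular point (0 : 1 : b^(1/2)) *)
  (Q \is 4.-homog /\ irreducible_form Q) /\
  (forall P : 'rV[k]_3, singular_point Q P <-> (P == pt 0 1 s)%MS) /\
  (* tangents at smooth points *)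
  (forall P : 'rV[k]_3, smooth_point Q P ->
     on_line (tangent_line Q P) (pt 0 0 1)) /\
  (forall P : 'rV[k]_3, smooth_point Q P ->
     bitangent Q (tangent_line Q P) \/
     on_line (tangent_line Q P) (pt 0 1 s)) /\
  (* inflection points *)
  (forall P : 'rV[k]_3, ~ ordinary_inflection_point Q P) /\
  (exists P1 P2 : 'rV[k]_3,
     [/\ ~ (P1 == P2)%MS,
         nonordinary_inflection_point Q P1,
         nonordinary_inflection_point Q P2 &
         forall P : 'rV[k]_3, nonordinary_inflection_point Q P ->
           (P == P1)%MS \/ (P == P2)%MS]) /\
  (* they are the points P such that some bitangent has P as its only
     tangency point *)
  (forall P : 'rV[k]_3, nonordinary_inflection_point Q P <->
     exists l : 'rV[k]_3,
       [/\ bitangent Q l, tangent_at Q l P &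
           forall P' : 'rV[k]_3, tangent_at Q l P' -> (P' == P)%MS]) /\
  (forall x y z : k, nonordinary_inflection_point Q (pt x y z) <->
     on_curve Q (pt x y z) /\ y ^+ 2 + x * y + a * x ^+ 2 = 0).
Proof.
have [hc he] : c != 0 /\ e != 0 by apply/andP; rewrite -negb_or -mulf_eq0.
have [r hr] := closed_sqrt a.
move=> Q; split.
  by split; [exact: quartic_homog | exact: (quartic_irreducible e hk hs hr hc)].
split; first exact: (singular_pointP hk hc he hs hr).
split; first by move=> P _; exact: (tangent_through_001 c e hk hs hr).
split.
  move=> P; have [x [y [z ->]]] := pt_coord P.
  have [d Ed] := closed_sqrt (conic a x y / e).
  by apply: (tangent_dichotomy hk hc he hs hr (d := d)); rewrite Ed mulrC divfK.
split; first by move=> P; exact: (no_ordinary hk he hs hr).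
split.
  have [t Et] := closed_artin_schreier a.
  have [v2 Ev2] := closed_sqrt (- c / e).
  have [v Ev] := closed_sqrt v2.
  apply: (two_nonordinary hk hc he hs hr Et (v := v)).
  by rewrite (exprM v 2 2) Ev Ev2 mulrC divfK // subrr.
split; first exact: (nonordinary_unique_tangencyP hk hc he hs hr).
exact: (nonordinaryP hk hc he hs hr).
Qed.
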